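(* Let $f,g\in G_B^I$. Then $f\boxtimes g\in G_B^I$ and the S-transform satisfies $$S_{f\boxtimes g}=S_g\cdot\big(S_f\circ(S_g^{-1}\cdot I\cdot S_g)\big),$$ where $S_g^{-1}$ denotes the multiplicative inverse of $S_g$ in $G_B^{\mathrm{inv}}$.
   Context: Let $B$ be a unital algebra over a field $\mathbb K$ of characteristic zero. $\mathrm{Mult}[[B]]$ is the set of sequences $f=(f_n)_{n\ge0}$ of $\mathbb K$-multilinear maps $f_n:B^{n}\to B$ (so $f_0\in B$). Product: $(f\cdot g)_n(x_1,\dots,x_n)=\sum_{k=0}^n f_k(x_1,\dots,x_k)\,g_{n-k}(x_{k+1},\dots,x_n)$, with unit $1=(\delta_{n,0}1_B)_n$. For $g$ with $g_0=0$, composition: $(f\circ g)_n(x_1,\dots,x_n)=\sum_{l\ge0}\sum_{k_1+\dots+k_l=n,\,k_i\ge1} f_l\big(g_{k_1}(x_1,\dots,x_{k_1}),\dots,g_{k_l}(x_{n-k_l+1},\dots,x_n)\big)$, with unit $I=(\delta_{n,1}\mathrm{id}_B)_n$. Composition binds tighter than product. $G_B^{\mathrm{inv}}=\{f: f_0\in B^\times\}$ is a group under $\cdot$; $G_B^{\mathrm{dif}}=\{f: f_0=0,\ f_1\in GL(B)\}$ is a group under $\circ$ (inverse $f^{\circ-1}$); $G_B^I=\{I\cdot F: F\in G_B^{\mathrm{inv}}\}\subseteq G_B^{\mathrm{dif}}$, where $(I\cdot F)_n(x_1,\dots,x_n)=x_1F_{n-1}(x_2,\dots,x_n)$. For $f\in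 G_B^I$, one has $f^{\circ-1}\in G_B^I$, and the S-transform $S_f\in G_B^{\mathrm{inv}}$ is defined by $f^{\circ-1}=I\cdot S_f$. Planar binary trees: $Y_0=\{|\}$ (the empty tree) and for $n\ge1$, $Y_n=\{\sigma\vee\tau:\sigma\in Y_k,\tau\in Y_l,k+l=n-1\}$, where $\sigma\vee\tau$ is the tree with a root whose left subtree is $\sigma$ and right subtree is $\tau$; $|\tau|$ is the number of internal vertices; $Y=\bigcup_n Y_n$. Every $\tau\in Y_n$, $n\ge1$, is uniquely written $\tau=\tau_1\vee(\tau_2\vee(\cdots\vee(\tau_k\vee|)\cdots))$ with $k\ge1$; put $j_i=|\tau_1|+\dots+|\tau_i|+i$ (so $j_0=0$, $j_k=n$). For $f,g\in\mathrm{Mult}[[B]]$ define recursively $(f\cup g)_|=1$ and $(f\cup g)_\tau(x_1,\dots,x_n)=g_k\big((g\cup f)_{\tau_1}(x_1,\dots,x_{j_1-1})x_{j_1},\ \dots,\ (g\cup f)_{\tau_k}(x_{j_{k-1}+1},\dots,x_{j_k-1})x_{j_k}\big)$ (the roles of $f,g$ alternate at each level). Define $R:Y\to Y$ by $R(|)=|$, $R(\sigma\vee\tau)=(|\vee R(\sigma))\vee R(\tau)$ (so $|R(\tau)|=2|\tau|$). The boxed convolution $f\boxtimes g\in\mathrm{Mult}[[B]]$ is $(f\boxtimes g)_0=g_0$ and for $n\ge1$, $(f\boxtimes g)_n(x_1,\dots,x_n)=\sum_{\tau\in Y_n}(f\cup g)_{R(\tau)}(x_1,1,x_2,1,\dots,x_n,1)$.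 *)

(* Defs.v *)
From HB Require Import structures.
From mathcomp Require Import all_boot all_order all_algebra.
From Stdlib Require Import ClassicalEpsilon.
Set Implicit Arguments. Unset Strict Implicit. Unset Printing Implicit Defensive.
Import GRing.Theory.
Local Open Scope ring_scope.

Inductive ptree : Type := Leaf | Node of ptree & ptree.

Fixpoint nverts (t : ptree) : nat :=
  match t with Leaf => 0%N | Node l r => (nverts l + nverts r).+1 end.

Fixpoint treesUpTo (n : nat) : seq (seq ptree) :=
  match n with
  | 0 => [:: [:: Leaf]]
  | n'.+1 =>
      let L := treesUpTo n' in
      rcons L (flatten [seq [seq Node s t | s <- nth [::] L k, t <- nth [::] L (n' - k)]
                       | k <- iota 0 n'.+1])
  end.

(* Y_n, the list (without repetition) of planar binary trees with n internal vertices *)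
Definition Ytrees (n : nat) : seq ptree := nth [::] (treesUpTo n) n.

Fixpoint Rtree (t : ptree) : ptree :=
  match t with Leaf => Leaf | Node s u => Node (Node Leaf (Rtree s)) (Rtree u) end.

Section MultSeries.
Variables (K : fieldType) (B : algType K).

(* An element f of Mult[[B]] is represented as a function on finite
   sequences: f_n(x_1,...,x_n) := f [:: x_1; ...; x_n]. *)
Definition mseries := seq B -> B.

Definition ismult (f : mseries) : Prop :=
  forall (s1 s2 : seq B) (a : K) (x y : B),
    f (s1 ++ (a *: x + y) :: s2) = a *: f (s1 ++ x :: s2) + f (s1 ++ y :: s2).

Definition mmul (f g : mseries) : mseries :=
  fun xs => \sum_(k < (size xs).+1) f (take k xs) * g (drop k xs).

Definition mone : mseries := fun xs => if xs is [::] then 1 else 0.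

Definition Iden : mseries := fun xs => if xs is [:: x] then x else 0.

Definition ext_first (x : B) (p : seq (seq B)) : seq (seq (seq B)) :=
  match p with [::] => [::] | b :: p' => [:: (x :: b) :: p'] end.

Fixpoint blocks (xs : seq B) : seq (seq (seq B)) :=
  match xs with
  | [::] => [:: [::]]
  | x :: s => [seq [:: x] :: p | p <- blocks s] ++ flatten [seq ext_first x p | p <- blocks s]
  end.

Definition mcomp (f g : mseries) : mseries :=
  fun xs => \sum_(p <- blocks xs) f (map g p).

Definition isunitB (b : B) : Prop := exists c : B, b * c = 1 /\ c * b = 1.

Definition inGinv (F : mseries) : Prop := ismult F /\ isunitB (F [::]).

Definition inGI (f : mseries) : Prop :=
  exists F : mseries, inGinv F /\ f = mmul Iden F.

Definition minv (F : mseries) : mseries :=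
  epsilon (inhabits mone) (fun H => mmul F H = mone /\ mmul H F = mone).

Definition compinv (f : mseries) : mseries :=
  epsilon (inhabits Iden)
    (fun h => ismult h /\ h [::] = 0 /\ mcomp f h = Iden /\ mcomp h f = Iden).

Definition Strans (f : mseries) : mseries :=
  epsilon (inhabits mone) (fun F => compinv f = mmul Iden F).

Fixpoint cup (f g : mseries) (t : ptree) (xs : seq B) {struct t} : B :=
  match t with
  | Leaf => 1
  | Node l r =>
      let m := nverts l in
      g ((cup g f l (take m xs) * nth 0 xs m) ::
         (fix args (u : ptree) (ys : seq B) {struct u} : seq B :=
            match u with
            | Leaf => [::]
            | Node l' r' =>
                let m' := nverts l' in
                (cup g f l' (take m' ys) * nth 0 ys m') :: args r' (drop m'.+1 ys)
            end) r (drop m.+1 xs))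
  end.

Definition interleave1 (xs : seq B) : seq B := flatten [seq [:: x; 1] | x <- xs].

Definition boxconv (f g : mseries) : mseries :=
  fun xs => if xs is [::] then g [::]
            else \sum_(t <- Ytrees (size xs)) cup f g (Rtree t) (interleave1 xs).

End MultSeries.

Arguments Iden {K B} _.
Arguments mone {K B} _.

(* Main.v *)
(** Write f = I·F and g = I·G. Summing over the subtrees of R(τ) according to
    the parity of their height gives two series A and C with
      A = I·(F ∘ (C·I)),  C = G ∘ A,  f ⊠ g = g ∘ A = A·C.
    Put h = f ⊠ g and D = C·I. From F·(S_f ∘ f) = 1 = G·(S_g ∘ g) one gets
    C·(S_g ∘ h) = 1 and (S_g^-1·I·S_g) ∘ h = C·A = D·(F ∘ D) = f ∘ D. Hence, for
    S the right-hand side of the formula, (I·S) ∘ h = A·(S_f ∘ f ∘ D) = I, and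
    I·S is the compositional inverse of h. *)
Require Import Defs.
From mathcomp Require Import all_boot all_order all_algebra.
From Stdlib Require Import ClassicalEpsilon FunctionalExtensionality.
Set Implicit Arguments. Unset Strict Implicit. Unset Printing Implicit Defensive.
Import GRing.Theory.
Local Open Scope ring_scope.

(** * Cuts of a word into two consecutive parts *)

Fixpoint splits (T : Type) (xs : seq T) : seq (seq T * seq T) :=
  match xs with
  | [::] => [:: ([::], [::])]
  | x :: s => ([::], x :: s) :: [seq (x :: p.1, p.2) | p <- splits s]
  end.

Section MemSplits.
Variables (T : eqType) (xs : seq T) (p : seq T * seq T).

Lemma mem_splits : p \in splits xs -> p.1 ++ p.2 = xs.
Proof.
elim: xs p => [|x s IHs] q /=; first by rewrite inE => /eqP->.
by rewrite inE => /orP[/eqP-> // | /mapP[r /IHs <- ->]].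
Qed.

Lemma size_splits2 : p \in splits xs -> (size p.2 <= size xs)%N.
Proof. by move=> /mem_splits <-; rewrite size_cat leq_addl. Qed.

Lemma size_splits1 : p \in splits xs -> (size p.1 <= size xs)%N.
Proof. by move=> /mem_splits <-; rewrite size_cat leq_addr. Qed.

End MemSplits.

Section SplitSums.
Variables (T : Type) (V : nmodType).
Implicit Types (xs s : seq T).

Lemma big_splits_cons x s (P : seq T -> seq T -> V) :
  \sum_(p <- splits (x :: s)) P p.1 p.2 =
  P [::] (x :: s) + \sum_(p <- splits s) P (x :: p.1) p.2.
Proof. by rewrite /= big_cons big_map. Qed.

Lemma big_splits_take_drop xs (P : seq T -> seq T -> V) :
  \sum_(p <- splits xs) P p.1 p.2 =
  \sum_(k < (size xs).+1) P (take k xs) (drop k xs).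
Proof.
elim: xs P => [|x s IHs] P; first by rewrite /= big_ord1 big_seq1.
by rewrite big_splits_cons big_ord_recl (IHs (fun a => P (x :: a))).
Qed.

(** Sorts the cuts by the side on which the marked letter [x] falls, as needed for linearity in that
    slot. *)
Lemma big_splits_cat_cons s1 x s2 (P : seq T -> seq T -> V) :
  \sum_(p <- splits (s1 ++ x :: s2)) P p.1 p.2 =
  \sum_(p <- splits s1) P p.1 (p.2 ++ x :: s2) +
  \sum_(p <- splits s2) P (s1 ++ x :: p.1) p.2.
Proof.
elim: s1 P => [|y s1 IHs] P; first by rewrite big_splits_cons /= big_seq1.
rewrite cat_cons (big_splits_cons y (s1 ++ x :: s2) P) (IHs (fun a => P (y :: a))).
by rewrite (big_splits_cons y s1 (fun a b => P a (b ++ x :: s2))) addrA.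
Qed.

(** Both sides enumerate the cuts of [xs] into three parts. This gives associativity of the product
    and the regroupings of blocks below. *)
Lemma big_splits3 xs (P : seq T -> seq T -> seq T -> V) :
  \sum_(p <- splits xs) \sum_(q <- splits p.2) P p.1 q.1 q.2 =
  \sum_(p <- splits xs) \sum_(q <- splits p.1) P q.1 q.2 p.2.
Proof.
elim: xs P => [|x s IHs] P; first by rewrite /= !big_seq1.
rewrite (big_splits_cons x s (fun a b => \sum_(q <- splits b) P a q.1 q.2)).
rewrite (big_splits_cons x s (fun a b => \sum_(q <- splits a) P q.1 q.2 b)).
rewrite (big_splits_cons x s (P [::])) (IHs (fun a => P (x :: a))).
rewrite /= big_seq1 -addrA -big_split /=; congr (_ + _).
by apply: eq_bigr => p _; rewrite big_cons big_map.
Qed.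

End SplitSums.

(** * Product and composition of series *)

Section MultSeriesTheory.
Variables (K : fieldType) (B : algType K).
Implicit Types (f g u v w : mseries B) (xs s : seq B).

(** Freezing the first argument turns product and composition into recursions on the word, with
    inductions that quantify over the series too. *)
Definition mshift f (y : B) : mseries B := fun l => f (y :: l).

(** [blocks] lengthens its first block one letter at a time; here that block is chosen at once, as a
    cut of the tail. *)
Lemma big_blocks_cons (V : nmodType) x s (P : seq (seq B) -> V) :
  \sum_(p <- blocks (x :: s)) P p =
  \sum_(q <- splits s) \sum_(p <- blocks q.2) P ((x :: q.1) :: p).
Proof.
elim: s x P => [|y s IHs] x P /=.
  by rewrite !big_seq1.
rewrite big_cat big_cons big_map big_map; congr (_ + _).
rewrite big_flatten big_map.
(* Decompositions of a nonempty word are nonempty, so [ext_first] returns exactly one list and this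
   sum has one term. *)
pose P' p := \sum_(r <- ext_first x p) P r.
by rewrite (IHs y P'); do 2! apply: eq_bigr => ? _; rewrite /P' /= big_seq1.
Qed.

(** Cutting between two blocks amounts to cutting the word and decomposing each side. Hence
    composition distributes over a product on its left. *)
Lemma big_blocks_splits (V : nmodType) xs (P : seq (seq B) -> seq (seq B) -> V) :
  \sum_(r <- blocks xs) \sum_(q <- splits r) P q.1 q.2 =
  \sum_(p <- splits xs) \sum_(a <- blocks p.1) \sum_(b <- blocks p.2) P a b.
Proof.
elim: {xs}(size xs) {-2}xs (leqnn (size xs)) P => [|n IHn] [|x s] // le_s P.
1,2: by rewrite /= !big_seq1.
rewrite -/(blocks (x :: s)) (big_blocks_cons x s).
under eq_bigr do under eq_bigr do rewrite (big_splits_cons _ _ P).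
rewrite (big_splits_cons x s
  (fun c d => \sum_(a <- blocks c) \sum_(b <- blocks d) P a b)).
rewrite [blocks [::]]/= big_seq1 (big_blocks_cons x s).
under eq_bigr do rewrite big_split.
rewrite big_split; congr (_ + _).
under [RHS]eq_bigr do rewrite big_blocks_cons.
rewrite -(big_splits3 s (fun c d e => \sum_(a <- blocks d)
   \sum_(b <- blocks e) P ((x :: c) :: a) b)).
apply: eq_big_seq => p /size_splits2 le_p.
by rewrite (IHn _ (leq_trans le_p le_s) (fun a => P ((x :: p.1) :: a))).
Qed.

Lemma mmulE u v xs : mmul u v xs = \sum_(p <- splits xs) u p.1 * v p.2.
Proof. by rewrite (big_splits_take_drop xs (fun a b => u a * v b)). Qed.

Lemma mmul_nil u v : mmul u v [::] = u [::] * v [::].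
Proof. by rewrite mmulE big_seq1. Qed.

Lemma mmul_cons u v x s :
  mmul u v (x :: s) = u [::] * v (x :: s) + mmul (mshift u x) v s.
Proof. by rewrite !mmulE (big_splits_cons x s (fun a b => u a * v b)). Qed.

Lemma mmulA u v w : mmul u (mmul v w) = mmul (mmul u v) w.
Proof.
apply: functional_extensionality => xs; rewrite !mmulE.
under eq_bigr do rewrite mmulE mulr_sumr.
rewrite (big_splits3 xs (fun a b c => u a * (v b * w c))).
apply: eq_bigr => p _; rewrite mmulE mulr_suml.
by apply: eq_bigr => q _; rewrite mulrA.
Qed.

Lemma mmul0 u v xs : (forall s, u s = 0) -> mmul u v xs = 0.
Proof. by move=> u0; rewrite mmulE big1 // => p _; rewrite u0 mul0r. Qed.

Lemma mul1m u : mmul mone u = u.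
Proof.
apply: functional_extensionality => -[|x s]; first by rewrite mmul_nil mul1r.
by rewrite mmul_cons mul1r mmul0 ?addr0.
Qed.

Lemma mulm1 u : mmul u mone = u.
Proof.
apply: functional_extensionality => xs.
elim: xs u => [|x s IHs] u; first by rewrite mmul_nil mulr1.
by rewrite mmul_cons mulr0 add0r IHs.
Qed.

Lemma mmulI_nil u : mmul Iden u [::] = 0.
Proof. by rewrite mmul_nil mul0r. Qed.

Lemma mmulI_cons u x s : mmul Iden u (x :: s) = x * u s.
Proof.
rewrite mmul_cons mul0r add0r; case: s => [|y s]; first by rewrite mmul_nil.
by rewrite mmul_cons mmul0 ?addr0.
Qed.

Lemma mmulI_inj u v : mmul Iden u = mmul Iden v -> u = v.
Proof.
move=> uv; apply: functional_extensionality => s.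
by rewrite -[LHS]mul1r -[RHS]mul1r -!mmulI_cons uv.
Qed.

Lemma mmul_rconsI u s z : mmul u Iden (rcons s z) = u s * z.
Proof.
elim: s u => [|x s IHs] u; first by rewrite /= mmul_cons mmul_nil mulr0 addr0.
rewrite rcons_cons mmul_cons IHs; case: s {IHs} => [|y s];
by rewrite mulr0 add0r.
Qed.

Lemma mcomp_nil u v : mcomp u v [::] = u [::].
Proof. exact: big_seq1. Qed.

Lemma mcomp_cons u v x s :
  mcomp u v (x :: s) =
  \sum_(p <- splits s) mcomp (mshift u (v (x :: p.1))) v p.2.
Proof. by rewrite /mcomp (big_blocks_cons x s (fun p => u (map v p))). Qed.

Lemma eq_mcomp u u' v : u =1 u' -> mcomp u v =1 mcomp u' v.
Proof. by move=> uu' xs; apply: eq_bigr. Qed.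

Lemma mcomp_lin (a : K) u u' v xs :
  mcomp (fun l => a *: u l + u' l) v xs = a *: mcomp u v xs + mcomp u' v xs.
Proof. by rewrite /mcomp scaler_sumr -big_split. Qed.

Lemma mcomp_mulr (b : B) u v xs :
  mcomp (fun l => b * u l) v xs = b * mcomp u v xs.
Proof. by rewrite /mcomp mulr_sumr. Qed.

Lemma mcomp_sum (I : Type) (r : seq I) (U : I -> mseries B) v xs :
  mcomp (fun l => \sum_(i <- r) U i l) v xs = \sum_(i <- r) mcomp (U i) v xs.
Proof. by rewrite /mcomp exchange_big. Qed.

Lemma mcomp0 v xs : mcomp (fun=> 0) v xs = 0.
Proof. exact: big1. Qed.

Lemma mcomp_mmul u v w : mcomp (mmul u v) w = mmul (mcomp u w) (mcomp v w).
Proof.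
apply: functional_extensionality => xs.
transitivity (\sum_(r <- blocks xs) \sum_(q <- splits r)
    u (map w q.1) * v (map w q.2)).
  apply: eq_bigr => r _; rewrite mmulE.
  elim: r u => [|b r IHr] u; first by rewrite !big_seq1.
  rewrite (big_splits_cons b r (fun a c => u (map w a) * v (map w c))).
  rewrite -(IHr (mshift u (w b))).
  by rewrite (big_splits_cons _ _ (fun a c => u a * v c)).
rewrite (big_blocks_splits xs (fun a b => u (map w a) * v (map w b))) mmulE.
apply: eq_bigr => p _; rewrite mulr_suml; apply: eq_bigr => a _.
by rewrite mulr_sumr.
Qed.

Lemma mcomp1 w : mcomp mone w = mone.
Proof.
apply: functional_extensionality => -[|x s]; first by rewrite mcomp_nil.
by rewrite mcomp_cons big1 // => p _; rewrite mcomp0.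
Qed.

Lemma mcompIl w : w [::] = 0 -> mcomp Iden w = w.
Proof.
move=> w0; apply: functional_extensionality => -[|x s].
  by rewrite mcomp_nil w0.
have shiftI p : mcomp (mshift Iden (w (x :: p.1))) w p.2 =
                w (x :: p.1) * mone p.2.
  rewrite -(mcomp1 w) -mcomp_mulr; apply: eq_mcomp => -[|? ?] //=.
  - by rewrite mulr1.
  - by rewrite mulr0.
rewrite mcomp_cons; under eq_bigr do rewrite shiftI.
by rewrite -(mmulE (mshift w x) mone) mulm1.
Qed.

(** * Multilinearity, associativity and right unit of composition *)

Section Multilinear.
Variable f : mseries B.
Hypothesis f_mult : ismult f.

Lemma ismult_shift y : ismult (mshift f y).
Proof. by move=> s1; apply: (f_mult (y :: s1)). Qed.

Lemma ismult0 s1 s2 : f (s1 ++ 0 :: s2) = 0.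
Proof.
have := f_mult s1 s2 1 0 0; rewrite !scale1r addr0 => /eqP.
by rewrite -subr_eq subrr => /eqP <-.
Qed.

Lemma ismult_sum (I : Type) (r : seq I) (y : I -> B) l :
  f ((\sum_(i <- r) y i) :: l) = \sum_(i <- r) f (y i :: l).
Proof.
elim: r => [|i r IHr]; first by rewrite !big_nil (ismult0 [::]).
by rewrite !big_cons -IHr -[y i]scale1r (f_mult [::]) !scale1r.
Qed.

End Multilinear.

Lemma ismult_mmul u v : ismult u -> ismult v -> ismult (mmul u v).
Proof.
move=> um vm s1 s2 a x y.
rewrite !mmulE !(big_splits_cat_cons _ _ _ (fun b c => u b * v c)).
rewrite scalerDr addrACA !scaler_sumr -!big_split; congr (_ + _).
  by apply: eq_bigr => p _; rewrite vm mulrDr scalerAr.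
by apply: eq_bigr => p _; rewrite um mulrDl scalerAl.
Qed.

Lemma ismult_mone : ismult (mone : mseries B).
Proof. by case=> [|? ?] s2 a x y; rewrite /= scaler0 addr0. Qed.

Lemma ismult_Iden : ismult (Iden : mseries B).
Proof.
by case=> [|? [|? ?]] [|? ?] a x y //=; rewrite scaler0 addr0.
Qed.

Lemma ismult_mcomp u v : ismult u -> ismult v -> ismult (mcomp u v).
Proof.
move=> um vm s1; elim: {s1}(size s1) {-2}s1 (leqnn (size s1)) u um => [|n IHn].
all: move=> [|z s1] //= le_s1 u um s2 a x y; rewrite ?cat_cons !mcomp_cons.
1,2: rewrite scaler_sumr -big_split; apply: eq_bigr => p _.
1,2: rewrite /= -mcomp_lin; apply: eq_mcomp => l.
1,2: by rewrite /mshift (vm [::]) (um [::]).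
(* The marked letter lies either beyond the first block, where induction applies, or inside it,
   where linearity of [v] and then of [u] does. *)
pose P b c := mcomp (mshift u (v (z :: b))) v c.
rewrite !(big_splits_cat_cons _ _ _ P) scalerDr addrACA !scaler_sumr.
rewrite -!big_split; congr (_ + _); last first.
  apply: eq_bigr => p _; rewrite /= -mcomp_lin; apply: eq_mcomp => l.
  by rewrite /mshift (vm (z :: s1)) (um [::]).
apply: eq_big_seq => p /size_splits2 le_p.
by apply: IHn; [apply: leq_trans le_p le_s1 | apply: ismult_shift].
Qed.

(** Both sides sum over two-level nestings of blocks; multilinearity of [u] takes the inner sums out
    of its arguments. *)
Lemma mcompA u v w : ismult u -> mcomp (mcomp u v) w = mcomp u (mcomp v w).
Proof.
move=> um; apply: functional_extensionality => xs.
elim: {xs}(size xs) {-2}xs (leqnn (size xs)) u um => [|n IHn] [|x s] //= le_s.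
1,2: by move=> u _; rewrite !mcomp_nil.
move=> u um; rewrite !mcomp_cons.
(* The first [v]-block consists of the [w]-block [x :: c] and the [w]-blocks in [a]; [d] is the rest
   of the word. *)
pose P c d a := mcomp (mshift u (v (w (x :: c) :: map w a))) (mcomp v w) d.
transitivity (\sum_(p <- splits s) \sum_(q <- splits p.2)
   \sum_(a <- blocks q.1) P p.1 q.2 a).
  apply: eq_big_seq => p /size_splits2 le_p.
  pose Q a b := mcomp (mshift u (v (w (x :: p.1) :: map w a))) v (map w b).
  transitivity (\sum_(r <- blocks p.2) \sum_(q <- splits r) Q q.1 q.2).
    apply: eq_bigr => r _; rewrite {1}/mshift mcomp_cons /Q.
    pose Q' a b := mcomp (mshift u (v (w (x :: p.1) :: a))) v b.
    rewrite (big_splits_take_drop (map w r) Q') (big_splits_take_drop r Q).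
    rewrite size_map; apply: eq_bigr => k _.
    by rewrite /Q' /Q map_take map_drop.
  rewrite big_blocks_splits; apply: eq_big_seq => q /size_splits2 le_q.
  apply: eq_bigr => a _; rewrite /P -IHn //; last exact: ismult_shift.
  exact: leq_trans le_q (leq_trans le_p le_s).
(* Rebracketing makes the outer cut the end of the first [v]-block, as on the right-hand side. *)
rewrite (big_splits3 s (fun c d e => \sum_(a <- blocks d) P c e a)).
apply: eq_bigr => p _; rewrite -/(mcomp v w).
under [RHS]eq_mcomp => l do
  rewrite /mshift mcomp_cons (ismult_sum um).
rewrite mcomp_sum; apply: eq_bigr => q _.
by rewrite -mcomp_sum; apply: eq_mcomp => l; rewrite /mshift -(ismult_sum um).
Qed.

Lemma mcompIr u : ismult u -> mcomp u Iden = u.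
Proof.
move=> um; apply: functional_extensionality => xs.
elim: xs u um => [|x s IHs] u um; first exact: mcomp_nil.
rewrite mcomp_cons; case: s IHs => [|y s] IHs.
  by rewrite big_seq1 mcomp_nil.
rewrite (big_splits_cons y s (fun a b => mcomp (mshift u (Iden (x :: a))) Iden b)).
(* A first block with at least two letters puts a zero in the first argument of [u]. *)
rewrite big1 ?addr0; first by rewrite IHs //; apply: ismult_shift.
move=> p _ /=; rewrite -[RHS](mcomp0 Iden p.2); apply: eq_mcomp => l.
exact: (ismult0 um [::]).
Qed.


(** * Fixed points of operators that gain a degree *)

Definition agree n u v := forall xs, (size xs < n)%N -> u xs = v xs.

(** Contraction for degreewise convergence. As [agree 0] is void, inductions on the degree start for
    free. *)
Definition contracting (Phi : mseries B -> mseries B) :=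
  forall n u v, agree n u v -> agree n.+1 (Phi u) (Phi v).

Lemma agree_leq m n u v : (m <= n)%N -> agree n u v -> agree m u v.
Proof. by move=> le_mn uv xs /leq_trans/(_ le_mn)/uv. Qed.

Lemma agree_mcomp n u v v' : agree n v v' -> agree n (mcomp u v) (mcomp u v').
Proof.
move=> vv' xs; elim: {xs}(size xs) {-2}xs (leqnn (size xs)) u => [|m IHm].
all: case=> [|x s] // le_s u lt_s; rewrite ?mcomp_nil ?mcomp_cons //.
apply: eq_big_seq => p ps; have le_p := size_splits2 ps.
have le_p1 : (size (x :: p.1) <= size (x :: s))%N := size_splits1 ps.
rewrite vv'; last exact: leq_ltn_trans le_p1 lt_s.
apply: IHm; first exact: leq_trans le_p le_s.
by apply: leq_ltn_trans le_p (ltnW lt_s).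
Qed.

Lemma agree_mmulI n u v :
  agree n u v -> agree n.+1 (mmul Iden u) (mmul Iden v).
Proof. by move=> uv [|x s] lt_s; rewrite ?mmulI_nil ?mmulI_cons ?uv. Qed.

Lemma agree_mmul_I n u v :
  agree n u v -> agree n.+1 (mmul u Iden) (mmul v Iden).
Proof.
move=> uv xs; case/lastP: xs => [|s z]; first by rewrite !mmul_nil !mulr0.
by rewrite size_rcons !mmul_rconsI => lt_s; rewrite uv.
Qed.

(** Iteration from the zero series stabilises in each degree. The limit is multilinear because one
    iterate computes it on all words of a given length. *)
Lemma contracting_fixpoint Phi :
    contracting Phi -> (forall u, ismult u -> ismult (Phi u)) ->
  exists2 u, ismult u & Phi u = u.
Proof.
move=> Phi_ctr Phi_mult; pose S n := iter n Phi (fun=> 0).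
have S_mult n : ismult (S n).
  by elim: n => [|n IHn]; [move=> *; rewrite scaler0 addr0 | apply: Phi_mult].
have agreeS n d : agree n (S n) (S (d + n)%N).
  by elim: n => [|n IHn] //; rewrite addnS; apply: Phi_ctr.
(* Iterates from the [n]-th on agree on words shorter than [n], hence the successor of the size. *)
pose L xs := S (size xs).+1 xs.
have agreeL n : agree n L (S n).
  by move=> xs lt_xs; rewrite -(subnK lt_xs); apply: agreeS.
exists L; last first.
  apply: functional_extensionality => xs.
  exact: (Phi_ctr _ _ _ (agreeL (size xs))).
by move=> s1 s2 a x y; rewrite /L !size_cat; apply: (S_mult (_ + (size s2).+1).+1).
Qed.

Lemma contracting_fixpoint_uniq Phi u v :
  contracting Phi -> Phi u = u -> Phi v = v -> u = v.
Proof.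
move=> Phi_ctr Phi_u Phi_v; apply: functional_extensionality => xs.
suff uv n : agree n u v by apply: (uv (size xs).+1).
by elim: n => [|n IHn] //; rewrite -Phi_u -Phi_v; apply: Phi_ctr.
Qed.

Definition mpos u : mseries B := fun xs => if xs is [::] then 0 else u xs.

Lemma mmul_mpos u v xs :
  mmul u v xs = mmul u (mpos v) xs + u xs * v [::].
Proof.
elim: xs u => [|x s IHs] u; first by rewrite !mmul_nil mulr0 add0r.
by rewrite !mmul_cons IHs addrA.
Qed.

(* The equation u · E(u) = 1 is solved for the degree-n part of u: it reads
   u_n = (1 - u · (E(u) - e))_n c, whose right side only involves u_k, k < n. *)
Lemma mmul_contracting_inv (E : mseries B -> mseries B) (e c : B) :
    e * c = 1 -> c * e = 1 -> contracting E ->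
    (forall u, ismult u -> ismult (E u)) -> (forall u, E u [::] = e) ->
  exists u, [/\ ismult u, u [::] = c & mmul u (E u) = mone].
Proof.
move=> ec ce E_ctr E_mult E0.
pose Phi u : mseries B := fun xs => (mone xs - mmul u (mpos (E u)) xs) * c.
have [||u um Phi_u] := @contracting_fixpoint Phi.
- move=> n u v uv xs lt_xs; rewrite /Phi !mmulE; congr ((_ - _) * _).
  apply: eq_big_seq => p /mem_splits p_xs.
  case: p => a [|b l] /= in p_xs *; first by rewrite !mulr0.
  have lt_xs' : (size a + (size l).+1 < n.+1)%N by rewrite -p_xs size_cat in lt_xs.
  rewrite uv; last by rewrite -ltnS (leq_trans _ lt_xs') // ltnS addnS ltnS leq_addr.
  by rewrite (E_ctr _ _ _ uv) // (leq_ltn_trans _ lt_xs') //= leq_addl.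
- move=> u um s1 s2 a x y; rewrite /Phi ismult_mone ismult_mmul //; last first.
    by case=> [|? ?] *; apply: (E_mult _ um [::]) || apply: (E_mult _ um (_ :: _)).
  by rewrite scalerAl -mulrDl scalerBr opprD addrACA.
exists u; split=> //.
  by rewrite -Phi_u /Phi mmul_nil mulr0 subr0 mul1r.
apply: functional_extensionality => xs.
by rewrite mmul_mpos E0 -{3}Phi_u /Phi -mulrA ce mulr1 addrC subrK.
Qed.

(** * Inverses for both operations and the S-transform *)

Lemma isunitBM (a b : B) : isunitB a -> isunitB b -> isunitB (a * b).
Proof.
move=> [a' [aa' a'a]] [b' [bb' b'b]]; exists (b' * a'); split.
  by rewrite mulrA -(mulrA a) bb' mulr1.
by rewrite mulrA -(mulrA b') a'a mulr1.
Qed.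

Lemma inGinv_mmul u v : inGinv u -> inGinv v -> inGinv (mmul u v).
Proof.
move=> [um uU] [vm vU]; split; first exact: ismult_mmul.
by rewrite mmul_nil; apply: isunitBM.
Qed.

Lemma inGinv_mcomp u v : inGinv u -> ismult v -> inGinv (mcomp u v).
Proof.
by move=> [um uU] vm; split; [apply: ismult_mcomp | rewrite mcomp_nil].
Qed.

Lemma inGinv_left_inv u : inGinv u -> exists2 v, inGinv v & mmul v u = mone.
Proof.
move=> [um [c [uc cu]]].
have u_ctr : contracting (fun=> u) by [].
have [//|//|v [vm v0 vu]] := mmul_contracting_inv uc cu u_ctr.
exists v => //; split; rewrite // v0.
by exists (u [::]).
Qed.

Lemma minvP u : inGinv u ->
  [/\ inGinv (minv u), mmul u (minv u) = mone & mmul (minv u) u = mone].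
Proof.
move=> uG; have [v vG vu] := inGinv_left_inv uG.
(* A left inverse of the left inverse [v] makes [v] two-sided, so that the choice defining [minv]
   has a candidate. *)
have [w _ wv] := inGinv_left_inv vG.
have uv : mmul u v = mone.
  by rewrite -[u]mul1m -wv -(mmulA w v u) vu mulm1 wv.
have [uM Mu] : mmul u (minv u) = mone /\ mmul (minv u) u = mone.
  exact: (epsilon_spec (inhabits mone)
    (fun H => mmul u H = mone /\ mmul H u = mone) (ex_intro _ v (conj uv vu))).
have <- : v = minv u by rewrite -[v]mulm1 -uM mmulA vu mul1m.
by split.
Qed.

Lemma ismult_inGI f : inGI f -> ismult f.
Proof.
by move=> [F [[Fm _] ->]]; apply: ismult_mmul => //; apply: ismult_Iden.
Qed.

(** For f = I·F and h = I·S one has f∘h = I·S·(F∘(I·S)), so it suffices to solve S·(F∘(I·S)) = 1.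
    The factor I makes the second factor contracting in S. *)
Lemma inGI_right_inv f :
  inGI f -> exists2 h, inGI h & mcomp f h = Iden.
Proof.
move=> [F [[Fm [c [Fc cF]]] ->]].
have [||//|S [Sm S0 SE]] :=
  @mmul_contracting_inv (fun S => mcomp F (mmul Iden S)) _ _ Fc cF.
- by move=> n u v /agree_mmulI; apply: agree_mcomp.
- by move=> u um; apply: ismult_mcomp => //; apply: ismult_mmul => //;
    apply: ismult_Iden.
- by move=> S; rewrite mcomp_nil.
exists (mmul Iden S).
  by exists S; split=> //; split=> //; rewrite S0; exists (F [::]).
by rewrite mcomp_mmul mcompIl ?mmulI_nil // -mmulA SE mulm1.
Qed.

(** A right inverse [h] that has a right inverse itself is two-sided. The chosen [compinv f] equals
    [h] and so inherits membership in [inGI]. *)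
Lemma compinvP f : inGI f ->
  [/\ inGI (compinv f), mcomp f (compinv f) = Iden
    & mcomp (compinv f) f = Iden].
Proof.
move=> fG; have [h hG fh] := inGI_right_inv fG.
have [k kG hk] := inGI_right_inv hG.
have [fm hm] := (ismult_inGI fG, ismult_inGI hG).
have k0 : k [::] = 0 by case: kG => F [_ ->]; rewrite mmulI_nil.
have h0 : h [::] = 0 by case: hG => F [_ ->]; rewrite mmulI_nil.
have hf : mcomp h f = Iden.
  suff -> : f = k by [].
  by rewrite -[f](mcompIr fm) -hk -mcompA // fh mcompIl.
have [cm [c0 [fc cf]]] : ismult (compinv f) /\ compinv f [::] = 0 /\
    mcomp f (compinv f) = Iden /\ mcomp (compinv f) f = Iden.
  exact: (epsilon_spec (inhabits Iden) (fun h => ismult h /\ h [::] = 0 /\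
    mcomp f h = Iden /\ mcomp h f = Iden)
    (ex_intro _ h (conj hm (conj h0 (conj fh hf))))).
have <- : h = compinv f by rewrite -[h](mcompIr hm) -fc -mcompA // hf mcompIl.
by split.
Qed.

Lemma StransP f : inGI f ->
  inGinv (Strans f) /\ compinv f = mmul Iden (Strans f).
Proof.
case/compinvP=> -[F [FG cF]] _ _.
have cS : compinv f = mmul Iden (Strans f).
  exact: (epsilon_spec (inhabits mone) (fun F => compinv f = mmul Iden F)
    (ex_intro _ F cF)).
by split=> //; rewrite -(@mmulI_inj F (Strans f)) // -cF.
Qed.

(** A left inverse of [f] coincides with [compinv f], so an S-transform can be identified by a
    single composition. *)
Lemma Strans_uniq f S : inGI f -> ismult S ->
  mcomp (mmul Iden S) f = Iden -> Strans f = S.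
Proof.
move=> fG Sm Sf; have [cG fc _] := compinvP fG; have [_ cS] := StransP fG.
have c0 : compinv f [::] = 0 by rewrite cS mmulI_nil.
have ISm : ismult (mmul Iden S) by apply: ismult_mmul => //; apply: ismult_Iden.
apply: mmulI_inj; rewrite -cS.
transitivity (mcomp (mcomp (mmul Iden S) f) (compinv f)).
  by rewrite Sf mcompIl.
by rewrite mcompA // fc mcompIr.
Qed.

(** Expanding (I·S_f)∘f = I for f = I·F gives I·F·(S_f∘f) = I, and I cancels on the left. *)
Lemma mmul_Strans (F : mseries B) : inGinv F ->
  mmul F (mcomp (Strans (mmul Iden F)) (mmul Iden F)) = mone.
Proof.
move=> FG; have fG : inGI (mmul Iden F) by exists F.
have [_ _ cf] := compinvP fG; have [_ cS] := StransP fG.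
apply: mmulI_inj; rewrite mulm1 -[RHS]cf cS mcomp_mmul mcompIl ?mmulI_nil //.
by rewrite mmulA.
Qed.

End MultSeriesTheory.

(** * Sums over planar binary trees *)

Lemma size_treesUpTo n : size (treesUpTo n) = n.+1.
Proof. by elim: n => //= n IHn; rewrite size_rcons IHn. Qed.

Lemma nth_treesUpTo n k : (k <= n)%N -> nth [::] (treesUpTo n) k = Ytrees k.
Proof.
elim: n => [|n IHn]; first by case: k.
rewrite leq_eqVlt => /orP[/eqP-> // | lt_kn].
by rewrite /= nth_rcons size_treesUpTo lt_kn IHn.
Qed.

Section TreeSums.
Variable V : nmodType.
Implicit Types P : ptree -> V.

Lemma big_YtreesS n P :
  \sum_(t <- Ytrees n.+1) P t =
  \sum_(k < n.+1) \sum_(a <- Ytrees k) \sum_(b <- Ytrees (n - k)) P (Node a b).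
Proof.
have -> : Ytrees n.+1 = nth [::] (rcons (treesUpTo n) (flatten
    [seq [seq Node a b | a <- nth [::] (treesUpTo n) k,
                         b <- nth [::] (treesUpTo n) (n - k)]
    | k <- iota 0 n.+1])) n.+1 by [].
rewrite nth_rcons size_treesUpTo ltnn eqxx big_flatten big_map.
rewrite -[iota 0 n.+1]/(index_iota 0 n.+1) big_mkord.
apply: eq_bigr => k _; rewrite big_allpairs_dep /=.
by rewrite !nth_treesUpTo ?leq_subr // -ltnS.
Qed.

(** [ptree] carries no [eqType] structure here, so the vertex count is threaded through the
    recursion instead of being read off from membership. *)
Lemma eq_big_Ytrees n P Q :
  (forall t, nverts t = n -> P t = Q t) ->
  \sum_(t <- Ytrees n) P t = \sum_(t <- Ytrees n) Q t.
Proof.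
have: (n <= n)%N by []; move: {2}n => m.
elim: m n P Q => [|m IHm] [|n] P Q // le_nm PQ.
1,2: by rewrite /Ytrees /= !big_seq1 PQ.
rewrite !big_YtreesS; apply: eq_bigr => k _.
apply: (IHm) => [|a size_a]; first exact: leq_trans (leq_ord k) le_nm.
apply: IHm => [|b size_b]; first exact: leq_trans (leq_subr k n) le_nm.
by apply: PQ; rewrite /= size_a size_b subnKC // -ltnS.
Qed.

(** Indexing the two subtrees by a cut of a word matches the recursion of [mcomp_cons]. *)
Lemma big_Ytrees_splits (T : Type) (s : seq T) P :
  \sum_(t <- Ytrees (size s).+1) P t =
  \sum_(p <- splits s) \sum_(a <- Ytrees (size p.1))
    \sum_(b <- Ytrees (size p.2)) P (Node a b).
Proof.
rewrite big_YtreesS (big_splits_take_drop s (fun c d =>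
  \sum_(a <- Ytrees (size c)) \sum_(b <- Ytrees (size d)) P (Node a b))).
by apply: eq_bigr => k _; rewrite size_takel ?size_drop // -ltnS.
Qed.

End TreeSums.

Lemma nverts_Rtree t : nverts (Rtree t) = (nverts t).*2.
Proof.
elim: t => //= a IHa b IHb.
by rewrite IHa IHb add0n doubleS doubleD addSn.
Qed.

(** * Summing the tree evaluations by composition *)

Section BoxConv.
Variables (K : fieldType) (B : algType K).
Implicit Types (f g u v w : mseries B) (xs s : seq B).

(** A named copy of the local fixpoint in [cup]: for a nonempty tree, [cup f g t xs] is
    [g (cupargs f g t xs)]. *)
Definition cupargs f g :=
  fix args (t : ptree) (xs : seq B) {struct t} : seq B :=
    match t with
    | Leaf => [::]
    | Node l r =>
        let m := nverts l in
        (cup g f l (take m xs) * nth 0 xs m) :: args r (drop m.+1 xs)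
    end.

Lemma cupargs_cat f g a r c y s : nverts a = size c ->
  cupargs f g (Node a r) (c ++ y :: s) =
  (cup g f a c * y) :: cupargs f g r s.
Proof.
move=> size_a; have -> : cupargs f g (Node a r) (c ++ y :: s) =
    (cup g f a (take (nverts a) (c ++ y :: s)) * nth 0 (c ++ y :: s) (nverts a))
    :: cupargs f g r (drop (nverts a).+1 (c ++ y :: s)) by [].
rewrite size_a take_size_cat // nth_cat ltnn subnn -cat_rcons.
by rewrite drop_size_cat // size_rcons.
Qed.

(** Every nonempty [Rtree] has this shape. Descending into its left subtree swaps [f] and [g], and
    the leaf there contributes 1 in front of [x]. *)
Lemma cupargs_node f g t r x l y s : nverts t = size l ->
  cupargs f g (Node (Node Leaf t) r) (x :: l ++ y :: s) =
  (f (x :: cupargs g f t l) * y) :: cupargs f g r s.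
Proof.
move=> size_t; rewrite -cat_cons cupargs_cat /= ?size_t //.
by rewrite drop0 mul1r.
Qed.

(** What is left of [interleave1] after its leading letter, up to a trailing 1. *)
Definition interleave1l xs : seq B := flatten [seq [:: 1; x] | x <- xs].

Lemma interleave1l_cat xs s :
  interleave1l xs ++ 1 :: s = 1 :: interleave1 xs ++ s.
Proof. by elim: xs => //= x xs ->. Qed.

Lemma size_interleave1 xs : size (interleave1 xs) = (size xs).*2.
Proof. by elim: xs => //= x xs ->. Qed.

Lemma size_interleave1l xs : size (interleave1l xs) = (size xs).*2.
Proof. by elim: xs => //= x xs ->. Qed.

Lemma interleave1_cat xs s :
  interleave1 (xs ++ s) = interleave1 xs ++ interleave1 s.
Proof. by rewrite /interleave1 map_cat flatten_cat. Qed.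

Lemma interleave1l_rcons_cat xs z s :
  interleave1l (rcons xs z ++ s) = 1 :: interleave1 xs ++ z :: interleave1l s.
Proof.
elim: xs => [//|x xs IHxs].
by rewrite -[LHS]/(1 :: x :: interleave1l (rcons xs z ++ s)) IHxs.
Qed.

Variables f g : mseries B.

(* [oddsum] is the sum of (g ∪ f)_(| ∨ R(t)) (x1, 1, x2, 1, ..., 1, xn), and
   [evensum] that of (f ∪ g)_(| ∨ R(t)) (1, x1, 1, ..., xn, 1). *)
Definition oddsum : mseries B := fun xs =>
  if xs is x :: s then
    \sum_(t <- Ytrees (size s)) f (x :: cupargs g f (Rtree t) (interleave1l s))
  else 0.

Definition evensum : mseries B := fun xs =>
  \sum_(t <- Ytrees (size xs)) g (1 :: cupargs f g (Rtree t) (interleave1 xs)).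

(** In R(a ∨ b), [a] carries the first block and [b] the rest. Summing over [a] inside the first
    argument of [u] produces [oddsum] of that block, and the letter after it is a 1. *)
Lemma sum_cupargs_odd u xs : ismult u ->
  \sum_(t <- Ytrees (size xs)) u (cupargs f g (Rtree t) (interleave1 xs)) =
  mcomp u oddsum xs.
Proof.
elim: {xs}(size xs) {-2}xs (leqnn (size xs)) u => [|n IHn] [|x s] // le_s u um.
1,2: by rewrite /Ytrees /= big_seq1 mcomp_nil.
rewrite mcomp_cons [size _]/= big_Ytrees_splits.
apply: eq_big_seq => p ps; have le_p := size_splits2 ps.
rewrite -IHn; [|exact: leq_trans le_p le_s|exact: ismult_shift].
rewrite exchange_big; apply: eq_bigr => b _.
rewrite /mshift ismult_sum //; apply: eq_big_Ytrees => a size_a.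
rewrite -(mem_splits ps) -cat_cons interleave1_cat.
rewrite -[interleave1 (x :: p.1)]/(x :: 1 :: interleave1 p.1).
rewrite !cat_cons -interleave1l_cat [Rtree _]/= cupargs_node ?mulr1 //.
by rewrite nverts_Rtree size_a size_interleave1l.
Qed.

Lemma sum_cupargs_even u xs : ismult u ->
  \sum_(t <- Ytrees (size xs)) u (cupargs g f (Rtree t) (interleave1l xs)) =
  mcomp u (mmul evensum Iden) xs.
Proof.
elim: {xs}(size xs) {-2}xs (leqnn (size xs)) u => [|n IHn] [|x s] // le_s u um.
1,2: by rewrite /Ytrees /= big_seq1 mcomp_nil.
rewrite mcomp_cons [size _]/= big_Ytrees_splits.
apply: eq_big_seq => p ps; have le_p := size_splits2 ps.
rewrite -IHn; [|exact: leq_trans le_p le_s|exact: ismult_shift].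
rewrite exchange_big; apply: eq_bigr => b _.
(* Here the letter multiplying the subtree is the last one of the first block, whence the right
   factor [Iden] of [evensum]. *)
rewrite -(mem_splits ps) -cat_cons lastI.
rewrite /mshift mmul_rconsI mulr_suml ismult_sum // size_belast.
apply: eq_big_Ytrees => a size_a.
rewrite interleave1l_rcons_cat [Rtree _]/= cupargs_node //.
by rewrite nverts_Rtree size_a size_interleave1 size_belast.
Qed.

Lemma boxconvE : ismult g -> boxconv f g = mcomp g oddsum.
Proof.
move=> gm; apply: functional_extensionality => -[|x s].
  by rewrite mcomp_nil.
rewrite -sum_cupargs_odd //.
by apply: eq_big_Ytrees => -[].
Qed.

End BoxConv.

(** * The functional equations of the two parity series *)

Section OddEven.
Variables (K : fieldType) (B : algType K) (F G : mseries B).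
Hypotheses (Fm : ismult F) (Gm : ismult G).
Let f := mmul Iden F.
Let g := mmul Iden G.

Lemma oddsumE : oddsum f g = mmul Iden (mcomp F (mmul (evensum f g) Iden)).
Proof.
apply: functional_extensionality => -[|x s]; first by rewrite mmulI_nil.
rewrite mmulI_cons -sum_cupargs_even // mulr_sumr.
by apply: eq_bigr => t _; rewrite {1}/f mmulI_cons.
Qed.

Lemma evensumE : evensum f g = mcomp G (oddsum f g).
Proof.
apply: functional_extensionality => xs.
rewrite -sum_cupargs_odd //; apply: eq_bigr => t _.
by rewrite {1}/g mmulI_cons mul1r.
Qed.

(** The equations for [oddsum] and [evensum] are mutually recursive. Eliminating [evensum] gives a
    contracting equation whose unique solution is multilinear. *)
Lemma ismult_oddsum : ismult (oddsum f g).
Proof.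
pose Phi (A : mseries B) := mmul Iden (mcomp F (mmul (mcomp G A) Iden)).
have Phi_ctr : contracting Phi.
  move=> n u v /(@agree_mcomp _ _ _ G) /agree_mmul_I.
  move=> /(@agree_mcomp _ _ _ F) /agree_mmulI.
  exact: agree_leq.
have [u um|A Am PhiA] := contracting_fixpoint Phi_ctr.
  have Im := @ismult_Iden K B.
  by do ![apply: ismult_mmul | apply: ismult_mcomp].
suff -> : oddsum f g = A by [].
by apply: (contracting_fixpoint_uniq Phi_ctr); rewrite // /Phi -evensumE -oddsumE.
Qed.

Lemma ismult_evensum : ismult (evensum f g).
Proof. by rewrite evensumE; apply: ismult_mcomp ismult_oddsum. Qed.

Lemma boxconv_mmul : boxconv f g = mmul (oddsum f g) (evensum f g).
Proof.
rewrite boxconvE; last by apply: ismult_mmul => //; apply: ismult_Iden.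
by rewrite {1}/g mcomp_mmul mcompIl // evensumE.
Qed.

End OddEven.

Theorem theorem3p2 (K : fieldType) (B : algType K)
    (charK0 : [pchar K] =i pred0) (f g : mseries B) :
  inGI f -> inGI g ->
  inGI (boxconv f g) /\
  Strans (boxconv f g) =
    mmul (Strans g)
      (mcomp (Strans f) (mmul (mmul (minv (Strans g)) Iden) (Strans g))).
Proof.
move=> fG gG; have [SfG _] := StransP fG; have [SgG _] := StransP gG.
have [VG SV _] := minvP SgG.
case: fG gG SfG SgG VG SV => F [FG ->] [G [GG ->]].
set f' := mmul Iden F; set g' := mmul Iden G.
move=> SfG SgG VG SV; have [[Fm F0] [Gm G0]] := (FG, GG).
have Im := @ismult_Iden K B.
pose A := oddsum f' g'; pose C := evensum f' g'; pose D := mmul C Iden.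
have Cm : ismult C by apply: ismult_evensum.
have Dm : ismult D by apply: ismult_mmul.
have CE : C = mcomp G A by apply: evensumE.
have AE : A = mmul Iden (mcomp F D) by apply: oddsumE.
have hE : boxconv f' g' = mmul A C by apply: boxconv_mmul.
have hgA : boxconv f' g' = mcomp g' A by apply: boxconvE; apply: ismult_mmul.
set h := boxconv f' g' in hE hgA *.
set Sf := Strans f' in SfG *; set Sg := Strans g' in SgG VG SV *.
have hG : inGI h.
  exists (mmul (mcomp F D) C); split; last by rewrite hE AE mmulA.
  apply: inGinv_mmul; first exact: inGinv_mcomp.
  by split; rewrite // CE mcomp_nil.
have h0 : h [::] = 0 by rewrite hE AE mmul_nil mmulI_nil mul0r.
split=> //; set W := mmul (mmul (minv Sg) Iden) Sg.
have Wm : ismult W by apply: ismult_mmul SgG.1; apply: ismult_mmul VG.1 _.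
apply: Strans_uniq => //.
  by apply: ismult_mmul SgG.1 _; apply: ismult_mcomp SfG.1 _.
pose X := mcomp Sg h.
have CX : mmul C X = mone.
  rewrite /X hgA -(mcompA _ _ SgG.1) CE -mcomp_mmul.
  by rewrite mmul_Strans // mcomp1.
(* [C] is a left inverse of [X] and [mcomp (minv Sg) h] a right one, so they agree. *)
have VhC : mcomp (minv Sg) h = C.
  rewrite -[LHS]mul1m -CX -mmulA -mcomp_mmul SV mcomp1.
  exact: mulm1.
have WhE : mcomp W h = mcomp f' D.
  rewrite /W 2!mcomp_mmul mcompIl // VhC -/X hE -!mmulA CX mulm1.
  by rewrite AE mmulA -/D /f' mcomp_mmul mcompIl // /D mmul_nil mulr0.
(* The composite is A·C·X·(S_f∘W∘h); C·X = 1 cancels and A = I·(F∘D) leaves I·((F·(S_f∘f))∘D). *)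
rewrite !mcomp_mmul mcompIl // -/X (mcompA _ _ SfG.1) WhE.
rewrite -(mcompA _ _ SfG.1) hE -mmulA (mmulA C) CX mul1m AE -mmulA.
by rewrite -mcomp_mmul mmul_Strans // mcomp1 mulm1.
Qed.
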